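(* $\mathcal{MR}\!\left(\frac{I_3}{3},\frac{I_4}{4}\right)=4=\lfloor\sqrt{3^2+4^2-1}\rfloor$.
   Context: $\mathbb{M}_n$ is the algebra of complex $n\times n$ matrices with identity $I_n$. A linear map $\Phi:\mathbb{M}_{d_1}\to\mathbb{M}_{d_2}$ is completely positive (CP) if and only if $\Phi(X)=\sum_{j=1}^r V_j^*XV_j$ for some complex $d_1\times d_2$ matrices $V_j$; the smallest possible $r$ is the Choi-rank $CR(\Phi)$. $\Phi^*:\mathbb{M}_{d_2}\to\mathbb{M}_{d_1}$ is the dual map defined by $\mathrm{tr}(\Phi(X)^*Y)=\mathrm{tr}(X^*\Phi^*(Y))$. For $A_1\in\mathbb{M}_{d_1}$, $A_2\in\mathbb{M}_{d_2}$, let $\mathcal{CP}[\mathbb{M}_{d_1},\mathbb{M}_{d_2};A_1,A_2]$ be the convex set of all CP maps $\Phi:\mathbb{M}_{d_1}\to\mathbb{M}_{d_2}$ with $\Phi(I_{d_1})=A_2$ and $\Phi^*(I_{d_2})=A_1$, and let $\mathcal{MR}(A_1,A_2)=\sup\{CR(\Phi):\Phi\text{ is an extreme point of }\mathcal{CP}[\mathbb{M}_{d_1},\mathbb{M}_{d_2};A_1,A_2]\}$. $\lfloor a\rfloor$ is the largest integer not exceeding $a$. Here $d_1=3$, $d_2=4$. *)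

(* Defs.v *)
From HB Require Import structures.
From mathcomp Require Export all_boot all_order all_algebra.
From mathcomp Require Export complex.
From mathcomp Require Export all_classical all_reals all_analysis.

Set Implicit Arguments.
Unset Strict Implicit.
Unset Printing Implicit Defensive.

Export Order.TTheory GRing.Theory Num.Theory.

#[export] Set Warnings "-notation-overridden".

Local Open Scope classical_set_scope.
Local Open Scope ring_scope.
Local Open Scope complex_scope.
Local Open Scope sesquilinear_scope.

(* Linear maps M_d1 -> M_d2 are elements of the C-vector space 'Hom('M_d1, 'M_d2),
   with C = R[i] for a realType R. *)
Notation mxmap R d1 d2 := 'Hom('M[R[i]]_d1, 'M[R[i]]_d2).

(* [M ^t*] is the conjugate transpose; [r = 0] is allowed (zero map). *)
Definition kraus_length (R : realType) (d1 d2 : nat) (Phi : mxmap R d1 d2)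
    (r : nat) : Prop :=
  exists V : 'I_r -> 'M[R[i]]_(d1, d2),
    forall X, Phi X = \sum_(j < r) (V j)^t* *m X *m V j.

Definition completely_positive (R : realType) (d1 d2 : nat)
    (Phi : mxmap R d1 d2) : Prop :=
  exists r, kraus_length Phi r.

(* The value is only meaningful on completely positive maps (0 otherwise). *)
Definition choi_rank (R : realType) (d1 d2 : nat) (Phi : mxmap R d1 d2) : nat :=
  xget 0%N [set r | kraus_length Phi r /\
                    forall s, kraus_length Phi s -> (r <= s)%N].

Definition dual_pair (R : realType) (d1 d2 : nat)
    (Phi : mxmap R d1 d2) (Psi : mxmap R d2 d1) : Prop :=
  forall X Y, \tr ((Phi X)^t* *m Y) = \tr (X^t* *m Psi Y).

(* Existence and uniqueness, so that the default value [0] of [xget] is never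
   used, are [dual_mapP] and [dual_map_unique] below. *)
Definition dual_map (R : realType) (d1 d2 : nat) (Phi : mxmap R d1 d2) :
    mxmap R d2 d1 :=
  xget 0 [set Psi | dual_pair Phi Psi].

Definition CP_set (R : realType) (d1 d2 : nat)
    (A1 : 'M[R[i]]_d1) (A2 : 'M[R[i]]_d2) : set (mxmap R d1 d2) :=
  [set Phi | [/\ completely_positive Phi, Phi 1%:M = A2
               & dual_map Phi 1%:M = A1]].

Definition extreme_point (R : realType) (E : lmodType R[i]) (S : set E)
    (x : E) : Prop :=
  S x /\ forall (y z : E) (t : R), S y -> S z -> 0 < t < 1 ->
    x = t%:C *: y + (1 - t)%:C *: z -> y = x /\ z = x.

(* The supremum is taken in the extended reals: it is -oo if there is no extreme
   point and +oo if the Choi ranks are unbounded. *)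
Definition MR (R : realType) (d1 d2 : nat)
    (A1 : 'M[R[i]]_d1) (A2 : 'M[R[i]]_d2) : \bar R :=
  ereal_sup [set ((choi_rank Phi)%:R)%:E | Phi in extreme_point (CP_set A1 A2)].

Lemma choi_rankP (R : realType) (d1 d2 : nat) (Phi : mxmap R d1 d2) :
  completely_positive Phi ->
  kraus_length Phi (choi_rank Phi) /\
  forall s, kraus_length Phi s -> (choi_rank Phi <= s)%N.
Proof.
move=> [r Hr]; rewrite /choi_rank.
apply: (xgetPex 0%N (P := [set r | kraus_length Phi r /\
                    forall s, kraus_length Phi s -> (r <= s)%N])).
have ex : exists n, `[< kraus_length Phi n >] by exists r; apply/asboolP.
case: (ex_minnP ex) => m /asboolP Hm min.
by exists m; split=> // s Hs; apply/min/asboolP.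
Qed.

Lemma dual_map_unique (R : realType) (d1 d2 : nat) (Phi : mxmap R d1 d2)
    (Psi1 Psi2 : mxmap R d2 d1) :
  dual_pair Phi Psi1 -> dual_pair Phi Psi2 -> Psi1 = Psi2.
Proof.
move=> H1 H2; apply/lfunP => Y; apply/matrixP => k l.
have E : forall Z : 'M[R[i]]_d1, \tr ((delta_mx k l)^t* *m Z) = Z k l.
  move=> Z; rewrite trmx_delta map_delta_mx /mxtrace (bigD1 l) //=.
  rewrite big1 ?addr0 => [|i il].
    rewrite mxE (bigD1 k) //= big1 ?addr0 => [|j jk].
      by rewrite !mxE !eqxx mul1r.
    by rewrite !mxE (negPf jk) andbF mul0r.
  by rewrite mxE big1 // => j _; rewrite !mxE (negPf il) mul0r.
by rewrite -!E -H1 H2.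
Qed.

Lemma dual_mapP (R : realType) (d1 d2 : nat) (Phi : mxmap R d1 d2) :
  dual_pair Phi (dual_map Phi).
Proof.
rewrite /dual_map.
apply: (xgetPex 0 (P := [set Psi | dual_pair Phi Psi])).
pose f (Y : 'M[R[i]]_d2) : 'M[R[i]]_d1 :=
  \matrix_(k, l) \tr ((Phi (delta_mx k l))^t* *m Y).
have lf : linear f.
  move=> a Y Z; apply/matrixP => k l.
  by rewrite !mxE mulmxDr -scalemxAr mxtraceD mxtraceZ.
pose fL := GRing.isLinear.Build _ _ _ _ f lf.
pose F : {linear 'M[R[i]]_d2 -> 'M[R[i]]_d1} := HB.pack f fL.
exists (linfun F) => X Y; rewrite lfunE /=.
transitivity (\sum_i \sum_j (X i j)^* * \tr ((Phi (delta_mx i j))^t* *m Y)).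
  rewrite {1}(matrix_sum_delta X) !linear_sum /= map_mx_sum mulmx_suml linear_sum.
  apply: eq_bigr => i _ /=.
  rewrite !linear_sum /= map_mx_sum mulmx_suml linear_sum.
  apply: eq_bigr => j _ /=.
  by rewrite !linearZ /= map_mxZ -scalemxAl mxtraceZ.
rewrite /mxtrace exchange_big /=; apply: eq_bigr => j _.
rewrite mxE; apply: eq_bigr => i _.
by rewrite !mxE.
Qed.

(* Main.v *)
Require Import Defs.
From HB Require Import structures.
From mathcomp Require Import ring.

(* A completely positive map is determined by its Choi matrix [M^* M], where
   the rows of [M] are the vectorised Kraus operators [V_j]; the Choi rank is
   the rank of [M].

   Upper bound: if [r] is the Choi rank and [r^2 >= d1^2 + d2^2], the matrices
   [V_i^* V_j (+) V_j V_i^*], which lie in the hyperplane of pairs of equal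
   trace, are linearly dependent; a Hermitian dependence [B] gives the two maps
   with Choi matrices [M^*(1 +- e B)M], whose midpoint is the given map.

   Lower bound: let [V_j], for [j] in [Z/(n+1)], be the [n x (n+1)] matrix whose
   row [a] is the basis vector with index [j+a+1], up to normalisation. The
   matrices [V_i^* V_j] are cyclic diagonals with one entry removed, hence
   linearly independent, so the map is extreme and has Choi rank [n + 1]. *)

Set Implicit Arguments.
Unset Strict Implicit.
Unset Printing Implicit Defensive.

Local Open Scope ring_scope.
Local Open Scope complex_scope.
Local Open Scope sesquilinear_scope.

(** * Gram matrices and domination between them *)

Section GramMatrices.

Variable C : numClosedFieldType.

Lemma adjmxM m n p (A : 'M[C]_(m, n)) (B : 'M[C]_(n, p)) :
  (A *m B)^t* = B^t* *m A^t*.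
Proof. by rewrite trmx_mul map_mxM. Qed.

Lemma adjmxZ m n (c : C) (A : 'M[C]_(m, n)) : (c *: A)^t* = c^* *: A^t*.
Proof. by apply/matrixP => i j; rewrite !mxE rmorphM. Qed.

Lemma adjmxD m n (A B : 'M[C]_(m, n)) : (A + B)^t* = A^t* + B^t*.
Proof. by apply/matrixP => i j; rewrite !mxE rmorphD. Qed.

Lemma gramZ m n (c : C) (A : 'M[C]_(m, n)) : 0 <= c ->
  (sqrtC c *: A)^t* *m (sqrtC c *: A) = c *: (A^t* *m A).
Proof.
move=> c0; rewrite adjmxZ -scalemxAl -scalemxAr scalerA.
by rewrite geC0_conj ?sqrtC_ge0 // -expr2 sqrtCK.
Qed.

Lemma gram_diag_ge0 m n (A : 'M[C]_(m, n)) i : 0 <= (A^t* *m A) i i.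
Proof.
by rewrite mxE sumr_ge0 // => k _; rewrite !mxE mulrC mul_conjC_ge0.
Qed.

(** Diagonal entries of a Gram matrix are sums of squared moduli, so a zero sum leaves no nonzero
    entry in [A]. *)
Lemma gram_add_eq0 m n p (A : 'M[C]_(m, n)) (B : 'M[C]_(p, n)) :
  A^t* *m A + B^t* *m B = 0 -> A = 0.
Proof.
move=> AB; apply/matrixP => k i; rewrite !mxE.
have /eqP := congr1 (fun M : 'M[C]_n => M i i) AB.
rewrite [in X in _ == X]mxE mxE paddr_eq0 ?gram_diag_ge0 // => /andP[/eqP + _].
rewrite mxE => A0; apply/eqP; rewrite -mul_conjC_eq0 mulrC.
have ge0 j : true -> 0 <= A^t* i j * A j i.
  by rewrite !mxE mulrC mul_conjC_ge0.
by have := psumr_eq0P ge0 A0 (i := k) isT; rewrite !mxE => ->.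
Qed.

(** On the cokernel [K] of [M] the left side vanishes, so the Gram matrices of [U *m K] and [W *m K]
    sum to 0. *)
Lemma gram_submx m n p q (M : 'M[C]_(m, n)) (W : 'M[C]_(p, n))
    (U : 'M[C]_(q, n)) :
  M^t* *m M = W^t* *m W + U^t* *m U -> (W <= M)%MS.
Proof.
move=> E; rewrite submxE; apply/eqP; set K := cokermx M.
apply: (@gram_add_eq0 _ _ _ _ (U *m K)).
transitivity (K^t* *m (M^t* *m M) *m K).
  by rewrite E mulmxDr mulmxDl !adjmxM !mulmxA.
by rewrite -!mulmxA mulmx_coker !mulmx0.
Qed.

Lemma gram_rank m n p (M : 'M[C]_(m, n)) (N : 'M[C]_(p, n)) :
  M^t* *m M = N^t* *m N -> \rank M = \rank N.
Proof.
move=> E; apply/eqP; rewrite eqn_leq; apply/andP; split; apply: mxrankS.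
  (* [U] is taken with no rows, which turns domination into equality. *)
  by apply: (@gram_submx _ _ _ 0 _ _ 0); rewrite mulmx0 addr0.
by apply: (@gram_submx _ _ _ 0 _ _ 0); rewrite mulmx0 addr0.
Qed.

Lemma gram_unitary m n (P : 'M[C]_m) (M : 'M[C]_(m, n)) : P \is unitarymx ->
  (P *m M)^t* *m (P *m M) = M^t* *m M.
Proof.
move=> Pu; rewrite adjmxM -mulmxA (mulmxA (P^t*)).
have : P^t* \is unitarymx by rewrite trmxC_unitary.
by move=> /unitarymxP; rewrite trmxCK => ->; rewrite mul1mx.
Qed.

Lemma hermitian_diag n (A : 'M[C]_n) : A^t* = A ->
  exists (P : 'M[C]_n) (d : 'rV[C]_n), [/\ P \is unitarymx, d \is a realmx
    & A = P^t* *m diag_mx d *m P].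
Proof.
move=> Ah.
have hA : A \is hermsymmx.
  by apply/is_hermitianmxP; rewrite expr0 scale1r Ah.
exists (spectralmx A), (spectral_diag A); split.
- exact: spectral_unitarymx.
- exact: hermitian_spectral_diag_real.
have /orthomx_spectralP {1}-> := hermitian_normalmx hA.
by rewrite invmx_unitary // spectral_unitarymx.
Qed.

Lemma gram_diag_weights m n (d : 'rV[C]_m) (M : 'M[C]_(m, n)) :
  (forall i, 0 <= d 0 i) ->
  exists N : 'M[C]_(m, n), M^t* *m diag_mx d *m M = N^t* *m N.
Proof.
move=> d0; exists (diag_mx (map_mx sqrtC d) *m M).
rewrite adjmxM !mulmxA; congr (_ *m _); rewrite -!mulmxA; congr (_ *m _).
apply/matrixP => i j; rewrite mul_mx_diag !mxE.
rewrite rmorphMn eq_sym; case: eqP => [->|_]; last by rewrite !mulr0n mul0r.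
by rewrite !mulr1n /= geC0_conj ?sqrtC_ge0 // -expr2 sqrtCK.
Qed.

End GramMatrices.

(** * Choi matrices, Kraus families and the two marginals *)

Section ChoiMatrices.

Variables (R : realType) (d1 d2 : nat).
Local Notation C := R[i].
Implicit Types (Phi : mxmap R d1 d2) (G : 'M[C]_(d1 * d2)).

(* Rows and columns of the Choi matrix [G] are indexed by pairs (input index,
   output index). *)
Definition choimap_fun G (X : 'M[C]_d1) : 'M[C]_d2 :=
  \matrix_(c, d) \sum_a \sum_b X a b * G (mxvec_index a c) (mxvec_index b d).

Lemma choimap_fun_is_linear G : linear (choimap_fun G).
Proof.
move=> t X Y; apply/matrixP => c d; rewrite !mxE mulr_sumr -big_split /=.
apply: eq_bigr => a _; rewrite mulr_sumr -big_split /=; apply: eq_bigr => b _.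
by rewrite !mxE mulrDl mulrA.
Qed.

HB.instance Definition _ G :=
  GRing.isLinear.Build _ _ _ _ (choimap_fun G) (choimap_fun_is_linear G).

Definition choimap G : mxmap R d1 d2 := linfun (choimap_fun G).

Lemma choimapE G X c d : choimap G X c d =
  \sum_a \sum_b X a b * G (mxvec_index a c) (mxvec_index b d).
Proof. by rewrite lfunE /= mxE. Qed.

Lemma choimap_delta G a b c d :
  choimap G (delta_mx a b) c d = G (mxvec_index a c) (mxvec_index b d).
Proof.
rewrite choimapE (bigD1 a) //= [X in _ + X]big1 ?addr0 => [|i /negPf ia].
  rewrite (bigD1 b) //= big1 ?addr0 => [|j /negPf jb].
    by rewrite mxE !eqxx mul1r.
  by rewrite mxE jb andbF mul0r.
by rewrite big1 // => j _; rewrite mxE ia mul0r.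
Qed.

Lemma choimap_is_linear : linear choimap.
Proof.
move=> t G H; apply/lfunP => X; rewrite add_lfunE scale_lfunE.
apply/matrixP => c d; rewrite [RHS]mxE [X in _ = X + _]mxE !choimapE.
rewrite mulr_sumr -big_split /=; apply: eq_bigr => a _.
rewrite mulr_sumr -big_split /=; apply: eq_bigr => b _.
by rewrite !mxE mulrDr mulrCA.
Qed.

HB.instance Definition _ :=
  GRing.isLinear.Build _ _ _ _ choimap choimap_is_linear.

Lemma choimapD G H : choimap (G + H) = choimap G + choimap H.
Proof. exact: linearD. Qed.

Lemma choimapZ t G : choimap (t *: G) = t *: choimap G.
Proof. exact: linearZ. Qed.

Lemma choimap_inj : injective choimap.
Proof.
move=> G H GH; apply/matrixP => p q.
case/mxvec_indexP: p => a c; case/mxvec_indexP: q => b d.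
by rewrite -!choimap_delta GH.
Qed.

Lemma choimap_eq0 G : choimap G = 0 -> G = 0.
Proof. by move=> G0; apply: choimap_inj; rewrite G0 linear0. Qed.

Lemma choimap_gram r (M : 'M[C]_(r, d1 * d2)) X : choimap (M^t* *m M) X =
  \sum_j (vec_mx (row j M))^t* *m X *m vec_mx (row j M).
Proof.
apply/matrixP => c d; rewrite choimapE summxE.
under [RHS]eq_bigr => j _ do rewrite mxE.
rewrite exchange_big [RHS]exchange_big /=; apply: eq_bigr => b _.
under [RHS]eq_bigr => j _ do rewrite [X in X * _]mxE mulr_suml.
rewrite [RHS]exchange_big /=; apply: eq_bigr => a _.
rewrite mxE mulr_sumr; apply: eq_bigr => j _.
by rewrite !mxE mulrCA mulrA.
Qed.

Lemma kraus_lengthP Phi r :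
  kraus_length Phi r <->
  exists M : 'M[C]_(r, d1 * d2), Phi = choimap (M^t* *m M).
Proof.
split=> [[V PhiE]|[M ->]]; last first.
  by exists (fun j => vec_mx (row j M)) => X; exact: choimap_gram.
exists (\matrix_j mxvec (V j)); apply/lfunP => X.
rewrite PhiE choimap_gram; apply: eq_bigr => j _.
by rewrite !rowK !mxvecK.
Qed.

Lemma completely_positive_gram r (M : 'M[C]_(r, d1 * d2)) :
  completely_positive (choimap (M^t* *m M)).
Proof. by exists r; apply/kraus_lengthP; exists M. Qed.

(** A shorter Kraus family would be a Gram factor of the same rank with fewer than [r] rows. *)
Lemma choi_rank_gram r (M : 'M[C]_(r, d1 * d2)) :
  row_free M -> choi_rank (choimap (M^t* *m M)) = r.
Proof.
move=> /eqP rM; have [] := choi_rankP (completely_positive_gram M).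
move=> /kraus_lengthP[N /choimap_inj/gram_rank E] minr.
apply/eqP; rewrite eqn_leq minr; last by apply/kraus_lengthP; exists M.
by apply: leq_trans (rank_leq_row N); rewrite -E rM.
Qed.

(* Rotating the Kraus family by a unitary that diagonalises [M M^*] makes its
   members orthogonal; a rank defect then shows up as a zero member, which can
   be dropped. *)
Lemma minimal_kraus_row_free r (M : 'M[C]_(r, d1 * d2)) :
  choi_rank (choimap (M^t* *m M)) = r -> row_free M.
Proof.
move=> rE; apply/negPn/negP => nfree.
have [P [d [Pu _ dE]]] : exists (P : 'M[C]_r) (d : 'rV[C]_r),
    [/\ P \is unitarymx, d \is a realmx & M *m M^t* = P^t* *m diag_mx d *m P].
  by apply: hermitian_diag; rewrite adjmxM trmxCK.
have PP : P *m P^t* = 1%:M by apply/unitarymxP.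
pose N := P *m M.
have NN : N *m N^t* = diag_mx d.
  rewrite /N adjmxM mulmxA -(mulmxA P) dE !mulmxA PP mul1mx.
  by rewrite -mulmxA PP mulmx1.
(* Were all eigenvalues nonzero, [M *m M^t*] would be invertible and [M] of full row rank. *)
have [i di] : exists i, d 0 i = 0.
  apply/not_existsP => d0; move: nfree.
  have : \det (M *m M^t*) != 0.
    rewrite dE !det_mulmx det_diag !mulf_neq0 //.
    - by rewrite -unitfE -unitmxE unitarymx_unit ?trmxC_unitary.
    - by apply/prodf_neq0 => i _; apply/eqP.
    - by rewrite -unitfE -unitmxE unitarymx_unit.
  rewrite -unitfE -unitmxE -row_free_unit /row_free => /eqP rk.
  by rewrite eqn_leq rank_leq_row /= -{1}rk mxrankM_maxl.
(* The squared norm of row [i] of [N] is the eigenvalue [d 0 i]. *)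
have Ni : row i N = 0.
  have : (row i N)^t* = 0.
    apply: (@gram_add_eq0 _ _ _ 0 _ 0); rewrite mulmx0 addr0 trmxCK.
    apply/matrixP => a b; rewrite !ord1 !mxE -[RHS]di.
    move/matrixP/(_ i i): NN; rewrite !mxE eqxx mulr1n => <-.
    by apply: eq_bigr => k _; rewrite !mxE.
  by move=> /(congr1 (fun A => A^t*)); rewrite trmxCK trmx0 map_mx0.
have [_ minr] := choi_rankP (completely_positive_gram M).
suff /minr : kraus_length (choimap (M^t* *m M)) r.-1.
  by rewrite rE; case: (r) i {Ni di} => [[]//|s] _; rewrite ltnn.
exists (fun j => vec_mx (row (lift i j) N)) => X.
rewrite -(gram_unitary _ Pu) choimap_gram (bigD1_ord i) //=.
by rewrite Ni linear0 mulmx0 add0r.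
Qed.

Lemma tr_adj_delta m (Z : 'M[C]_m) k l : \tr ((delta_mx k l)^t* *m Z) = Z k l.
Proof.
rewrite trmx_delta map_delta_mx /mxtrace (bigD1 l) //= big1 ?addr0 => [|i il].
  rewrite mxE (bigD1 k) //= big1 ?addr0 => [|j jk].
    by rewrite !mxE !eqxx mul1r.
  by rewrite !mxE (negPf jk) andbF mul0r.
by rewrite mxE big1 // => j _; rewrite !mxE (negPf il) mul0r.
Qed.

Lemma tr_adj m (Z : 'M[C]_m) : \tr (Z^t*) = (\tr Z)^*%R.
Proof. by rewrite /mxtrace rmorph_sum; apply: eq_bigr => i _; rewrite !mxE. Qed.

(* The entrywise conjugate of [Phi^*(I)], in a form linear in [Phi]. *)
Definition input_marginal Phi : 'M[C]_d1 :=
  \matrix_(k, l) \tr (Phi (delta_mx k l)).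

Lemma dual_map1 Phi : dual_map Phi 1%:M = map_mx Num.conj (input_marginal Phi).
Proof.
apply/matrixP => k l.
by rewrite -tr_adj_delta -(dual_mapP Phi) mulmx1 tr_adj !mxE.
Qed.

Lemma CP_set_marginals A1 A2 Phi Psi : CP_set A1 A2 Phi ->
  completely_positive Psi -> Psi 1%:M = Phi 1%:M ->
  input_marginal Psi = input_marginal Phi -> CP_set A1 A2 Psi.
Proof.
move=> [_ E2 E1] cp P1 Pm; split; first exact: cp.
  by rewrite P1.
by rewrite dual_map1 Pm -dual_map1.
Qed.

Lemma input_marginal_is_linear : linear input_marginal.
Proof.
move=> t Phi Psi; apply/matrixP => k l.
by rewrite !mxE add_lfunE scale_lfunE mxtraceD mxtraceZ.
Qed.

HB.instance Definition _ :=
  GRing.isLinear.Build _ _ _ _ input_marginal input_marginal_is_linear.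

Lemma input_marginalD Phi Psi :
  input_marginal (Phi + Psi) = input_marginal Phi + input_marginal Psi.
Proof. exact: linearD. Qed.

Lemma input_marginalZ t Phi :
  input_marginal (t *: Phi) = t *: input_marginal Phi.
Proof. exact: linearZ. Qed.

(** This is the relation between the two marginals that makes the linear conditions on a
    perturbation dependent. *)
Lemma tr_input_marginal Phi : \tr (input_marginal Phi) = \tr (Phi 1%:M).
Proof.
by rewrite mx1_sum_delta !linear_sum /=; apply: eq_bigr => k _; rewrite mxE.
Qed.

Lemma choimap_adj G X : choimap (G^t*) (X^t*) = (choimap G X)^t*.
Proof.
apply/matrixP => c d; rewrite 2!mxE !choimapE exchange_big rmorph_sum /=.
apply: eq_bigr => a _; rewrite rmorph_sum; apply: eq_bigr => b _.
by rewrite rmorphM !mxE.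
Qed.

End ChoiMatrices.

(** * Extreme points: the bound on the Choi rank and a sufficient criterion *)

Section ExtremePoints.

Variables (R : realType) (d1 d2 : nat).
Local Notation C := R[i].

(** With the trace written as a product with a fixed column, an equality of traces becomes a column
    killed by a matrix. *)
Lemma mxvec_mul1 m (A : 'M[C]_m) :
  mxvec A *m (mxvec (1%:M : 'M[C]_m))^T = (\tr A)%:M.
Proof.
apply/matrixP => i j; rewrite !ord1 !mxE mulr1n.
rewrite (reindex _ (curry_mxvec_bij m m)) /=.
rewrite (eq_bigr (fun p => A p.1 p.2 * (p.1 == p.2)%:R)); last first.
  by case=> a b _ /=; rewrite mxE !mxvecE mxE.
rewrite -(pair_bigA _ (fun a b => A a b * (a == b)%:R)) /=.
apply: eq_bigr => a _; rewrite (bigD1 a) //= eqxx mulr1 big1 ?addr0 // => b.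
by rewrite eq_sym => /negPf->; rewrite mulr0.
Qed.

Section Perturbations.

Variables (r : nat) (M : 'M[C]_(r, d1 * d2)).

Let perturb (u : 'rV[C]_(r * r)) := choimap (M^t* *m vec_mx u *m M).

Let marginals (u : 'rV[C]_(r * r)) : 'rV[C]_(d2 * d2 + d1 * d1) :=
  row_mx (mxvec (perturb u 1%:M)) (mxvec (input_marginal (perturb u))).

Let marginals_is_linear : linear marginals.
Proof.
move=> t u v; rewrite /marginals.
have -> : perturb (t *: u + v) = t *: perturb u + perturb v.
  rewrite /perturb [vec_mx _]linearP mulmxDr mulmxDl -scalemxAr -scalemxAl.
  exact: choimap_is_linear.
rewrite add_lfunE scale_lfunE input_marginal_is_linear.
by rewrite ![mxvec _]linearP scale_row_mx add_row_mx.
Qed.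

HB.instance Definition _ :=
  GRing.isLinear.Build _ _ _ _ marginals marginals_is_linear.

(* Both marginals have the same trace, so the [d2^2 + d1^2] linear conditions
   on the [r^2] unknowns are dependent. *)
Lemma marginal_free_perturbation : (0 < d1)%N -> (d1 ^ 2 + d2 ^ 2 <= r ^ 2)%N ->
  exists B : 'M[C]_r, [/\ B != 0, choimap (M^t* *m B *m M) 1%:M = 0
    & input_marginal (choimap (M^t* *m B *m M)) = 0].
Proof.
move=> d1_gt0 dr; pose F := lin1_mx marginals.
(* [h] encodes the difference of the traces of the two blocks; [F] kills it and so lacks full column
   rank. *)
pose h : 'cV[C]_(d2 * d2 + d1 * d1) :=
  col_mx (mxvec (1%:M : 'M[C]_d2))^T (- (mxvec (1%:M : 'M[C]_d1))^T).
have Fh : F *m h = 0.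
  apply/row_matrixP => i; rewrite row_mul rowE mul_rV_lin1 /= /marginals.
  by rewrite mul_row_col mulmxN !mxvec_mul1 tr_input_marginal subrr row0.
have h0 : h != 0.
  apply: contraTneq d1_gt0 => /(congr1 dsubmx).
  rewrite col_mxKd linear0 => /eqP; rewrite oppr_eq0 => /eqP /(congr1 trmx).
  rewrite trmxK trmx0.
  case: d1 => [//|n] /(congr1 (fun A => vec_mx A 0 0)) /eqP.
  by rewrite mxvecK linear0 !mxE eqxx oner_eq0.
have : ~~ row_free F.
  rewrite /row_free neq_ltn; apply/orP; left.
  apply: (@leq_trans (d2 * d2 + d1 * d1)); last by rewrite addnC !mulnn.
  rewrite ltn_neqAle rank_leq_col andbT; apply: contra h0 => /row_fullP[A AF].
  by rewrite -[h]mul1mx -AF -mulmxA Fh mulmx0.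
rewrite -kermx_eq0 => /rowV0Pn[u /sub_kermxP]; rewrite mul_rV_lin1 /= => fu u0.
exists (vec_mx u); move: fu; rewrite /marginals -row_mx0 => /eq_row_mx[].
move=> /(canRL (@mxvecK _ _ _)) E1 /(canRL (@mxvecK _ _ _)) E2.
by split; rewrite ?E1 ?E2 ?linear0 // vec_mx_eq0.
Qed.

(** The conditions pass from [B] to its adjoint, so [B + B^t*] works unless it is zero; in that case
    [B] is skew-Hermitian and ['i *: B] works. *)
Lemma hermitian_marginal_free_perturbation :
  (0 < d1)%N -> (d1 ^ 2 + d2 ^ 2 <= r ^ 2)%N ->
  exists B : 'M[C]_r, [/\ B != 0, B^t* = B, choimap (M^t* *m B *m M) 1%:M = 0
    & input_marginal (choimap (M^t* *m B *m M)) = 0].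
Proof.
move=> d1_gt0 dr; have [B [B0 E1 E2]] := marginal_free_perturbation d1_gt0 dr.
have MBM : (M^t* *m B *m M)^t* = M^t* *m B^t* *m M.
  by rewrite !adjmxM trmxCK mulmxA.
have E1' : choimap (M^t* *m B^t* *m M) 1%:M = 0.
  have -> : (1%:M : 'M[C]_d1) = 1%:M^t* by rewrite trmx1 map_mx1.
  by rewrite -MBM choimap_adj E1 trmx0 map_mx0.
have E2' : input_marginal (choimap (M^t* *m B^t* *m M)) = 0.
  apply/matrixP => k l; rewrite mxE.
  have -> : delta_mx k l = (delta_mx l k : 'M[C]_d1)^t*.
    by rewrite trmx_delta map_delta_mx.
  rewrite -MBM choimap_adj tr_adj.
  by move/matrixP: E2 => /(_ l k); rewrite !mxE => ->; rewrite rmorph0.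
have [S0|S0] := eqVneq (B + B^t*) 0.
  exists ('i *: B); split.
  - by rewrite scaler_eq0 negb_or neq0Ci.
  - rewrite adjmxZ conjCi scaleNr -scalerN; congr (_ *: _).
    by apply/esym/eqP; rewrite -addr_eq0 S0.
  - by rewrite -scalemxAr -scalemxAl choimapZ scale_lfunE E1 scaler0.
  - by rewrite -scalemxAr -scalemxAl choimapZ input_marginalZ E2 scaler0.
exists (B + B^t*); split.
- exact: S0.
- by rewrite adjmxD trmxCK addrC.
- have -> : M^t* *m (B + B^t*) *m M = M^t* *m B *m M + M^t* *m B^t* *m M.
    by rewrite mulmxDr mulmxDl.
  by rewrite choimapD add_lfunE [X in X + _]E1 [X in _ + X]E1' addr0.
- have -> : M^t* *m (B + B^t*) *m M = M^t* *m B *m M + M^t* *m B^t* *m M.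
    by rewrite mulmxDr mulmxDl.
  by rewrite choimapD input_marginalD [X in X + _]E2 [X in _ + X]E2' addr0.
Qed.

(* In the Kraus family rotated so that [B] becomes [diag d], the maps
   [M^*(1 + t B)M] have Kraus weights [1 + t d i]. *)
Lemma perturbed_gram_cp (B : 'M[C]_r) : B^t* = B ->
  exists2 e : C, 0 < e & forall t : C, t \is Num.real -> `|t| <= e ->
    completely_positive (choimap (M^t* *m M + t *: (M^t* *m B *m M))).
Proof.
move=> /hermitian_diag[P [d [Pu dr ->]]].
have s0 : 0 <= \sum_i `|d 0 i| by apply: sumr_ge0 => i _.
have s1 : 0 < 1 + \sum_i `|d 0 i| by apply: ltr_wpDr.
(* The sum bounds every single modulus, so each weight [1 + t d i] stays nonnegative; the added 1
   covers [d = 0]. *)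
exists (1 + \sum_i `|d 0 i|)^-1; first by rewrite invr_gt0.
move=> t tr te; pose w : 'rV[C]_r := const_mx 1 + t *: d.
have w0 i : 0 <= w 0 i.
  have td_real : t * d 0 i \is Num.real.
    by rewrite realM //; exact: (mxOverP dr).
  have td_le1 : `|t * d 0 i| <= 1.
    rewrite normrM.
    apply: (@le_trans _ _ ((1 + \sum_i `|d 0 i|)^-1 * (1 + \sum_i `|d 0 i|))).
      apply: ler_pM => //; rewrite (bigD1 i) //= addrCA lerDl.
      by rewrite addr_ge0 // sumr_ge0.
    by rewrite mulVf // gt_eqF.
  rewrite !mxE -lerBlDl sub0r.
  by move: td_le1; rewrite real_ler_norml // => /andP[].
have -> : M^t* *m M + t *: (M^t* *m (P^t* *m diag_mx d *m P) *m M) =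
    (P *m M)^t* *m diag_mx w *m (P *m M).
  rewrite -(gram_unitary M Pu) /w linearD linearZ /= diag_const_mx.
  by rewrite mulmxDr mulmxDl mulmx1 -scalemxAr -scalemxAl adjmxM !mulmxA.
have [N ->] := gram_diag_weights (P *m M) w0.
exact: completely_positive_gram.
Qed.

End Perturbations.

Lemma extreme_choi_rank (A1 : 'M[C]_d1) (A2 : 'M[C]_d2) (Phi : mxmap R d1 d2) :
  (0 < d1)%N -> extreme_point (CP_set A1 A2) Phi ->
  (choi_rank Phi ^ 2 < d1 ^ 2 + d2 ^ 2)%N.
Proof.
move=> d1_gt0 [SPhi ext]; rewrite ltnNge; apply/negP => dr.
have [cpPhi _ _] := SPhi; have [/kraus_lengthP[M PhiE] _] := choi_rankP cpPhi.
have Mfree : row_free M by apply: minimal_kraus_row_free; rewrite -PhiE.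
have [B [B0 Bh E1 E2]] := hermitian_marginal_free_perturbation M d1_gt0 dr.
have [e e0 cp] := perturbed_gram_cp M Bh.
pose Psi t := choimap (M^t* *m M + t *: (M^t* *m B *m M)).
have PsiE t : Psi t = Phi + t *: choimap (M^t* *m B *m M).
  by rewrite /Psi choimapD choimapZ -PhiE.
have er : e \is Num.real by exact: gtr0_real.
have S t : t \is Num.real -> `|t| <= e -> CP_set A1 A2 (Psi t).
  move=> tr te; apply: (CP_set_marginals SPhi); first exact: cp.
    by rewrite PsiE add_lfunE scale_lfunE E1 scaler0 addr0.
  by rewrite PsiE input_marginalD input_marginalZ E2 scaler0 addr0.
have half01 : 0 < (2^-1 : R) < 1 by rewrite invr_gt0 ltr0n invf_lt1 ?ltr1n.
have [||//|PsiPhi _] := ext (Psi e) (Psi (- e)) 2^-1 _ _ half01.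
- by apply: S; rewrite ?gtr0_norm.
- by apply: S; rewrite ?realN ?normrN ?gtr0_norm.
- have -> : 1 - 2^-1 = 2^-1 :> R by rewrite [X in X - _]splitr div1r addrK.
  rewrite -scalerDr !PsiE addrACA scaleNr subrr addr0 -mulr2n.
  rewrite -[Phi *+ 2]scaler_nat scalerA -(rmorph_nat (real_complex R)) -rmorphM.
  by rewrite mulVf ?pnatr_eq0 // rmorph1 scale1r.
move: PsiPhi; rewrite PsiE => /(canRL (addKr _)); rewrite addNr => /eqP.
rewrite scaler_eq0 gt_eqF //= => /eqP /choimap_eq0 MBM.
case/negP: B0; apply/eqP.
(* Row freeness cancels [M] on the right and, after taking adjoints, [M^t*] on the left. *)
have MB : M^t* *m B = 0.
  by apply: (row_free_inj Mfree); rewrite /= MBM mul0mx.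
rewrite -Bh; apply: (row_free_inj Mfree); rewrite mul0mx.
by rewrite -[LHS]trmxCK adjmxM trmxCK MB trmx0 map_mx0.
Qed.

(* The Choi matrices of the two end points are dominated by multiples of
   [M^* M], so their Kraus operators lie in the row space of [M]. *)
Lemma extreme_point_gram (A1 : 'M[C]_d1) (A2 : 'M[C]_d2) r
    (M : 'M[C]_(r, d1 * d2)) :
  CP_set A1 A2 (choimap (M^t* *m M)) ->
  (forall B, choimap (M^t* *m B *m M) 1%:M = 0 -> B = 0) ->
  extreme_point (CP_set A1 A2) (choimap (M^t* *m M)).
Proof.
move=> SM indep; split=> // y z t Sy Sz t01 E.
(* Stated for one end point; the other follows by exchanging [t] and [1 - t]. *)
have key s w v : 0 < s < 1 -> CP_set A1 A2 w -> CP_set A1 A2 v ->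
    choimap (M^t* *m M) = s%:C *: w + (1 - s)%:C *: v ->
    w = choimap (M^t* *m M).
  move=> /andP[s0 s1] [[p /kraus_lengthP[W ->]] E2 _].
  move=> [[q /kraus_lengthP[U ->]] _ _]; rewrite -!choimapZ -choimapD.
  move=> /choimap_inj; rewrite -!gramZ ?lecR ?subr_ge0 ?ltW // => MWU.
  have /submxP[a aE] := gram_submx MWU.
  have s0C : sqrtC s%:C != 0 by rewrite sqrtC_eq0 gt_eqF // ltcR.
  have {}aE : W = (sqrtC s%:C)^-1 *: a *m M.
    by rewrite -scalemxAl -aE scalerA mulVf // scale1r.
  set b := _ *: a in aE.
  have WW : W^t* *m W = M^t* *m (b^t* *m b) *m M by rewrite aE adjmxM !mulmxA.
  (* [w] and the given map agree at the identity, so [indep] applies to this difference. *)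
  suff /eqP : b^t* *m b - 1%:M = 0.
    by rewrite subr_eq0 WW => /eqP->; rewrite mulmx1.
  apply: indep; rewrite mulmxBr mulmxBl mulmx1 -scaleN1r choimapD choimapZ.
  rewrite scaleN1r add_lfunE opp_lfunE -WW E2.
  by case: SM => _ -> _; rewrite subrr.
split; first exact: (key t y z).
have t01' : 0 < 1 - t < 1 by rewrite subr_gt0 ltrBlDr ltrDl andbC.
by apply: (key _ _ _ t01' Sz Sy); rewrite subKr addrC.
Qed.

End ExtremePoints.

(** * An extreme point built from cyclic shifts *)

Section ShiftExample.

Variables (R : realType) (n : nat).
Hypothesis n_gt0 : (0 < n)%N.
Local Notation C := R[i].

(* The [j]-th row is the vectorisation of the [n x (n+1)] matrix whose row [a]
   is the basis vector with index [j + a + 1] modulo [n + 1]. *)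
Definition shift_kraus : 'M[C]_(n.+1, n * n.+1) :=
  \matrix_j mxvec (\matrix_(a < n, b < n.+1) (j == b - lift ord0 a)%:R).

Lemma shift_krausE j a b :
  shift_kraus j (mxvec_index a b) = (j == b - lift ord0 a)%:R.
Proof. by rewrite mxE mxvecE mxE. Qed.

(** Column [(a, c)] of [shift_kraus] has a single 1, in row [c - (a + 1)]; [lift ord0 a] is [a + 1],
    so the shift 0 never occurs. *)
Lemma shift_gramE (B : 'M[C]_n.+1) a b c d :
  (shift_kraus^t* *m B *m shift_kraus) (mxvec_index a c) (mxvec_index b d) =
  B (c - lift ord0 a) (d - lift ord0 b).
Proof.
rewrite mxE (bigD1 (d - lift ord0 b)) //= shift_krausE eqxx mulr1.
rewrite big1 ?addr0 => [|j /negPf jd]; last by rewrite shift_krausE jd mulr0.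
rewrite mxE (bigD1 (c - lift ord0 a)) //= 2!mxE shift_krausE eqxx rmorph1 mul1r.
rewrite big1 ?addr0 // => j /negPf jc.
by rewrite 2!mxE shift_krausE jc rmorph0 mul0r.
Qed.

Lemma shift_choimap1 (B : 'M[C]_n.+1) c d :
  choimap (shift_kraus^t* *m B *m shift_kraus) 1%:M c d =
  \sum_(a < n) B (c - lift ord0 a) (d - lift ord0 a).
Proof.
rewrite choimapE; apply: eq_bigr => a _.
rewrite (bigD1 a) //= mxE eqxx mul1r shift_gramE big1 ?addr0 // => b.
by rewrite mxE eq_sym => /negPf->; rewrite mul0r.
Qed.

(* Adding the term [a = 0] to [shift_choimap1] gives a sum over a full cyclic
   diagonal, so [B] equals its own diagonal sums, which are constant along
   cyclic diagonals. *)
Lemma shift_gram_independent (B : 'M[C]_n.+1) :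
  choimap (shift_kraus^t* *m B *m shift_kraus) 1%:M = 0 -> B = 0.
Proof.
move=> B0; pose T c d := \sum_(k < n.+1) B (c - k) (d - k).
have TE c d : T c d = B c d.
  rewrite /T big_ord_recl !subr0 -shift_choimap1.
  by rewrite B0 mxE addr0.
have Tshift c d k : T (c - k) (d - k) = T c d.
  rewrite [RHS](reindex_inj (addrI k)) /=; apply: eq_bigr => l _.
  by rewrite !opprD !addrA.
apply/matrixP => c d; rewrite mxE -TE; apply/eqP.
(* All [n + 1] terms of the sum equal [T c d], so [n] times it is 0. *)
have : T c d = T c d *+ n.+1.
  rewrite {1}/T; under eq_bigr => k _ do rewrite -TE Tshift.
  by rewrite sumr_const card_ord.
move=> /eqP; rewrite mulrS addrC -subr_eq subrr eq_sym mulrn_eq0.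
by rewrite eqn0Ngt n_gt0.
Qed.

Lemma shift_row_free : row_free shift_kraus.
Proof.
apply: inj_row_free => v v0; apply/rowP => j; rewrite mxE.
(* Column [(0, j + 1)] has its only 1 in row [j], which isolates the coefficient [v 0 j]. *)
move/rowP/(_ (mxvec_index (Ordinal n_gt0) (j + lift ord0 (Ordinal n_gt0)))): v0.
rewrite !mxE (bigD1 j) //= shift_krausE addrK eqxx mulr1 big1 ?addr0 // => i.
by move=> /negPf ij; rewrite shift_krausE addrK ij mulr0.
Qed.

(** Before scaling, the map sends the identity to [n] times the identity and its dual to [n + 1]
    times; [w] turns these factors into [1/(n+1)] and [1/n]. *)
Let w : C := (n * n.+1)%:R^-1.

Let w_neq0 : w != 0.
Proof. by rewrite invr_eq0 pnatr_eq0 muln_eq0 orbF -lt0n. Qed.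

Let w_ge0 : 0 <= w. Proof. by rewrite invr_ge0 ler0n. Qed.

Let M := sqrtC w *: shift_kraus.

Let M_gram (B : 'M[C]_n.+1) :
  M^t* *m B *m M = w *: (shift_kraus^t* *m B *m shift_kraus).
Proof.
rewrite adjmxZ -!scalemxAl -scalemxAr scalerA.
by rewrite geC0_conj ?sqrtC_ge0 // -expr2 sqrtCK.
Qed.

Let M_gram1 : M^t* *m M = w *: (shift_kraus^t* *m 1%:M *m shift_kraus).
Proof. by rewrite -M_gram mulmx1. Qed.

Let M_CP_set : CP_set (n%:R^-1 *: 1%:M : 'M[C]_n)
  (n.+1%:R^-1 *: 1%:M : 'M[C]_n.+1) (choimap (M^t* *m M)).
Proof.
split; first exact: completely_positive_gram.
  rewrite M_gram1 choimapZ scale_lfunE; apply/matrixP => c d.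
  rewrite mxE shift_choimap1 [RHS]mxE mxE.
  under eq_bigr => a _ do rewrite mxE (inj_eq (addIr _)).
  rewrite sumr_const card_ord -[_ *+ n]mulr_natl mulrA; congr (_ * _).
  by rewrite /w natrM invfM mulrAC mulVf ?mul1r // pnatr_eq0 -lt0n.
rewrite dual_map1 M_gram1 choimapZ input_marginalZ.
apply/matrixP => k l; rewrite !mxE.
rewrite /mxtrace; under eq_bigr => c _.
  rewrite choimap_delta shift_gramE mxE (inj_eq (addrI _)) (inj_eq oppr_inj).
  rewrite (inj_eq lift_inj); over.
rewrite sumr_const card_ord -[_ *+ n.+1]mulr_natl mulrA.
rewrite !rmorphM !rmorph_nat /= geC0_conj //; congr (_ * _).
by rewrite /w natrM invfM mulrVK ?unitfE ?pnatr_eq0.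
Qed.

Lemma extreme_point_of_choi_rank : exists2 Phi : mxmap R n n.+1,
  extreme_point (CP_set (n%:R^-1 *: 1%:M) (n.+1%:R^-1 *: 1%:M)) Phi &
  choi_rank Phi = n.+1.
Proof.
exists (choimap (M^t* *m M)).
  apply: extreme_point_gram M_CP_set _ => B.
  rewrite M_gram choimapZ scale_lfunE.
  move=> /eqP; rewrite scaler_eq0 (negPf w_neq0) => /eqP.
  exact: shift_gram_independent.
apply: choi_rank_gram; apply: inj_row_free => v /eqP.
rewrite -scalemxAr scaler_eq0 sqrtC_eq0 (negPf w_neq0) => /eqP v0.
by apply: (row_free_inj shift_row_free); rewrite /= v0 mul0mx.
Qed.

End ShiftExample.

Theorem corollary5p6 (R : realType) :
  MR (3%:R^-1 *: 1%:M : 'M[R[i]]_3) (4%:R^-1 *: 1%:M : 'M[R[i]]_4)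
    = (4%:R : R)%:E
  /\ 4 = Num.floor (Num.sqrt (3 ^+ 2 + 4 ^+ 2 - 1 : R)) :> int.
Proof.
split.
  apply/eqP; rewrite eq_le; apply/andP; split.
    apply: ge_ereal_sup => _ [Phi /extreme_choi_rank Phi25 <-].
    (* Since [3^2 + 4^2 = 5^2], the strict bound on the squared rank says that the rank is below
       5. *)
    have {}Phi25 := Phi25 isT; rewrite lee_fin ler_nat leqNgt.
    by apply: contraTN Phi25 => ltr; rewrite -leqNgt (@leq_sqr 5).
  have [//|Phi ext rk] := @extreme_point_of_choi_rank R 3.
  by apply: ereal_sup_ubound; exists Phi; rewrite ?rk.
have -> : 3 ^+ 2 + 4 ^+ 2 - 1 = 24 :> R by ring.
have sq (k : nat) : k%:R = Num.sqrt (k ^ 2)%:R :> R.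
  by rewrite natrX sqrtr_sqr ger0_norm.
(* 24 lies between [4^2] and [5^2]. *)
apply/esym/floor_def; rewrite -[4%:~R]/(4%:R : R) -[(4 + 1)%:~R]/(5%:R : R).
by rewrite (sq 4) (sq 5) ler_sqrt ?ltr_sqrt ?ler0n ?ltr0n // ler_nat ltr_nat.
Qed.
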